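(* Let $a>1$ be an integer and let $c$ be a rational number such that $a/c$ is a positive integer. Let $\omega=e^{2\pi i/3}$. Then the following hold, where $F$ is the function defined in the context. If $a/c>1$, then $$\left [0;\overline{\frac{a^{2k-1}}{c}-1,\frac{a^{2k}}{c}+1}\right ]_{k=1}^{\infty}=\frac{(c/a)\,F(-c \omega /a, \omega^{2},-1/a)}{(1+c \omega^{2}/a)\,F(c \omega , \omega^{2},-1/a)}$$ and $$\left [0;\overline{\frac{a^{2k-1}}{c}+1,\frac{a^{2k}}{c}-1}\right ]_{k=1}^{\infty}=\frac{(c/a)\,F(c \omega /a, \omega^{2},-1/a)}{(1-c \omega^{2}/a)\,F(-c \omega , \omega^{2},-1/a)}.$$ If $a/c>2$, then $$\left [0;\frac{a}{c}-2,\overline{1,\frac{a^{k+1}}{c}-3}\right ]_{k=1}^{\infty}=\frac{(c/a)\,F(-c \omega /a, \omega^{2},1/a)}{(1+c \omega^{2}/a)\,F(-c \omega , \omega^{2},1/a)}$$ and $$\left [0;\overline{1,\frac{a^{k}}{c}-1}\right ]_{k=1}^{\infty}=1-\frac{(c/a)\,F(c \omega /a, \omega^{2},1/a)}{(1-c \omega^{2}/a)\,F(c \omega , \omega^{2},1/a)}.$$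
   Context: For complex $x,y,q$ with $|q|<1$, define $$F(x,y,q):=\sum_{n=0}^{\infty}\frac{(-1)^{n}x^{n}q^{n(n+1)/2}}{(q;q)_{n}\,(xq/y;q)_{n}},$$ where $(z;q)_0:=1$ and $(z;q)_n:=\prod_{j=0}^{n-1}(1-zq^{j})$ for $n\ge 1$. $[a_0;a_1,a_2,\ldots]$ denotes the (value of the) infinite regular continued fraction $a_0+\cfrac{1}{a_1+\cfrac{1}{a_2+\cdots}}$. The notation $[a_0;a_1,\ldots,a_j,\overline{f_1(k),\ldots,f_r(k)}\,]_{k=1}^{\infty}$ means that after $a_j$ the partial quotients are $f_1(1),\ldots,f_r(1),f_1(2),\ldots,f_r(2),f_1(3),\ldots$, i.e. the blocks $f_1(k),\ldots,f_r(k)$ for $k=1,2,3,\ldots$ concatenated in order. *)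

(* Defs.v *)
From Stdlib Require Import Reals QArith Qreals List.
From Coquelicot Require Import Coquelicot.
Import ListNotations.

Open Scope R_scope.

(* As with [Series], the value is meaningful only for convergent series;
   see [CSeries_unique]. *)
Definition CSeries (u : nat -> C) : C :=
  (Series (fun n => Re (u n)), Series (fun n => Im (u n))).

Lemma CSeries_unique (u : nat -> C) (l : C) :
  @is_series R_AbsRing C_R_NormedModule u l -> CSeries u = l.
Proof.
intros H.
assert (Hre : is_series (fun n => Re (u n)) (Re l)).
{ apply filterlim_ext with (fun n => fst (sum_n u n)).
  - intros n; induction n as [|n IH].
    + now rewrite !sum_O.
    + now rewrite !sum_Sn, <- IH.
  - refine (filterlim_comp _ _ _ _ fst _ _ _ H _).
    intros P [e He]; exists e; intros y Hy; apply He, Hy. }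
assert (Him : is_series (fun n => Im (u n)) (Im l)).
{ apply filterlim_ext with (fun n => snd (sum_n u n)).
  - intros n; induction n as [|n IH].
    + now rewrite !sum_O.
    + now rewrite !sum_Sn, <- IH.
  - refine (filterlim_comp _ _ _ _ snd _ _ _ H _).
    intros P [e He]; exists e; intros y Hy; apply He, Hy. }
unfold CSeries.
rewrite (is_series_unique _ _ Hre), (is_series_unique _ _ Him).
now destruct l.
Qed.

Definition Cexp (z : C) : C :=
  (exp (Re z) * cos (Im z), exp (Re z) * sin (Im z)).

Definition omega : C := Cexp (2 * PI * Ci / 3)%C.

Fixpoint qpoch (z q : C) (n : nat) : C :=
  match n with
  | O => 1
  | S m => (qpoch z q m * (1 - z * q ^ m))%C
  end.

Definition F (x y q : C) : C :=
  CSeries (fun n : nat =>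
    ((- (1)) ^ n * x ^ n * q ^ (n * (n + 1) / 2)%nat
     / (qpoch q q n * qpoch (x * q / y) q n))%C).

Fixpoint convergent (s : nat -> R) (n : nat) : R :=
  match n with
  | O => s O
  | S m => s O + / convergent (fun i => s (S i)) m
  end.

Definition regular_cf (s : nat -> R) : Prop :=
  (forall n : nat, exists z : Z, s n = IZR z) /\
  (forall n : nat, (1 <= n)%nat -> 0 < s n).

Definition regular_cf_value (s : nat -> R) (z : C) : Prop :=
  regular_cf s /\
  exists v : R, is_lim_seq (convergent s) v /\ RtoC v = z.

(* The sequence of partial quotients consisting of the list [pre], followed by
   the blocks f_1(k), ..., f_r(k) for k = 1, 2, 3, ..., where [fs] is the list
   of the functions f_1, ..., f_r. *)
Definition blocks (pre : list R) (fs : list (nat -> R)) (n : nat) : R :=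
  if (n <? length pre)%nat then nth n pre 0
  else
    let m := (n - length pre)%nat in
    nth (m mod length fs)%nat fs (fun _ => 0) (m / length fs + 1)%nat.

(* Main.v *)
Require Import Defs.
From Stdlib Require Import Reals ZArith QArith Qreals List Lra Lia.
From Coquelicot Require Import Coquelicot.
Import ListNotations.
Open Scope R_scope.

(** Write [t = x q / y].  A telescoping sum ([F_qdiff]) gives the second-order
    q-difference equation
      F(x) = (1 - xq - t)/(1 - t) F(xq) - x t q^2/((1 - t)(1 - tq)) F(xq^2).
    Take [y = omega^2], [x = sigma c omega], [q = eps / a] with signs
    [eps, sigma].  Along the orbit [x q^n], put [d = sigma eps^(n+1) c / a^(n+1)]:
    then [x q^n q = d omega] and [t = d omega^2], so
    [1 + omega + omega^2 = 0] turns the first numerator into the real number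
    [1 + d], and [omega^3 = 1] turns the second one into
    [eps (c/a^(n+1)) (c/a^(n+2))].  After rescaling by the finite products
    [shift_weight], the values [F(x q^n)] become a sequence [X]
    ([decaying_recurrence]) with
      X_n = (a^(n+1)/c + sigma eps^(n+1)) X_(n+1) - eps X_(n+2).
    It tends to 0 because [F(x q^n)] tends to 1 ([F_near_1]) while the weights
    decay.  The quotient of the theorem is [X_1 / X_0] ([decaying_ratio]).

    A continued fraction with partial quotients at least 1 is determined by any
    nonzero solution of its recurrence [Y_n = s_(n+1) Y_(n+1) + Y_(n+2)] that
    tends to 0: its value is [s_0 + Y_1 / Y_0]
    ([regular_cf_value_of_decaying]).  The solution may be complex: that the
    quotient of values of [F] is real, and that its denominator is nonzero, are
    consequences of the convergents being real and of the decay of [Y].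

    For [eps = -1] the recurrence for [X] already has this form.  For [eps = 1]
    its minus sign is removed by interleaving [X_k] with the differences
    [X_k - X_(k+1)], which inserts the partial quotients equal to 1. *)

(** * Continued fractions from three-term recurrences *)

Definition stail {A : Type} (s : nat -> A) : nat -> A := fun n => s (S n).

Lemma convergent_ge_1 (s : nat -> R) (n : nat) :
  (forall k, 1 <= s k) -> 1 <= convergent s n.
Proof.
  revert s; induction n as [|n IH]; intros s Hs; simpl.
  - apply Hs.
  - assert (H1 : 1 <= convergent (fun i => s (S i)) n) by (apply IH; intros; apply Hs).
    assert (H2 : 0 < / convergent (fun i => s (S i)) n) by (apply Rinv_0_lt_compat; lra).
    specialize (Hs 0%nat); lra.
Qed.

Lemma regular_cf_ge_1 (s : nat -> R) :
  regular_cf s -> forall n, (1 <= n)%nat -> 1 <= s n.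
Proof.
  intros [Hint Hpos] n Hn.
  destruct (Hint n) as [z Hz]; specialize (Hpos n Hn); rewrite Hz in *.
  apply IZR_le; apply lt_IZR in Hpos; lia.
Qed.

(** Passing to the tails of [s] and [Y] divides the error by minus the convergent
    of the tail of [s], which is at least 1; iterating, the error after [n]
    steps is at most that of the constant convergent of the [n]-th tails,
    namely [Y (S n)]. *)
Lemma convergent_error (s : nat -> R) (Y : nat -> C) (n : nat) :
  (forall k, (1 <= k)%nat -> 1 <= s k) ->
  (forall k, Y k = (s (S k) * Y (S k) + Y (S (S k)))%C) ->
  Cmod (convergent s n * Y 0%nat - (s 0%nat * Y 0%nat + Y 1%nat)) <= Cmod (Y (S n)).
Proof.
  revert s Y; induction n as [|n IH]; intros s Y Hs HY.
  - simpl.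
    replace (s 0%nat * Y 0%nat - (s 0%nat * Y 0%nat + Y 1%nat))%C
      with (- Y 1%nat)%C by ring.
    rewrite Cmod_opp; lra.
  - assert (Ht : 1 <= convergent (stail s) n)
      by (apply convergent_ge_1; intros k; apply Hs; lia).
    specialize (IH (stail s) (stail Y)); unfold stail in IH at 1 2 5.
    specialize (IH ltac:(intros; apply Hs; lia) ltac:(intros; apply HY)).
    change (convergent s (S n)) with (s 0%nat + / convergent (stail s) n).
    set (t := convergent (stail s) n) in *.
    assert (Ht0 : RtoC t <> 0) by (intros E; apply RtoC_inj in E; lra).
    rewrite RtoC_plus, RtoC_inv by lra.
    replace ((s 0%nat + / t) * Y 0%nat - (s 0%nat * Y 0%nat + Y 1%nat))%C
      with (- / t * (t * stail Y 0%nat - (stail s 0%nat * stail Y 0%nat + stail Y 1%nat)))%C.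
    2:{ unfold stail; rewrite (HY 0%nat); field; exact Ht0. }
    rewrite Cmod_mult, Cmod_opp, Cmod_inv, Cmod_R, Rabs_pos_eq by (exact Ht0 || lra).
    assert (0 < / t <= 1).
    { split; [apply Rinv_0_lt_compat; lra|].
      rewrite <- Rinv_1; apply Rinv_le_contravar; lra. }
    pose proof (Cmod_ge_0 (t * stail Y 0%nat - (stail s 0%nat * stail Y 0%nat + stail Y 1%nat))).
    unfold stail in *.
    nra.
Qed.

Lemma Im_le_Cmod (z : C) : Rabs (Im z) <= Cmod z.
Proof. eapply Rle_trans; [apply Rmax_r | apply (Rmax_Cmod z)]. Qed.

(** The imaginary part of [z] is at most the distance from [z] to any real
    number. *)
Lemma real_limit_of_complex (v : nat -> R) (z : C) :
  is_lim_seq (fun n => Cmod (v n - z)) 0 ->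
  is_lim_seq v (Re z) /\ RtoC (Re z) = z.
Proof.
  intros H; split.
  - apply is_lim_seq_ext with (fun n => (v n - Re z) + Re z); [intros; ring|].
    replace (Finite (Re z)) with (Finite (0 + Re z)) by (f_equal; ring).
    apply is_lim_seq_plus'; [|apply is_lim_seq_const].
    apply is_lim_seq_abs_0.
    eapply is_lim_seq_le_le; [|apply is_lim_seq_const|exact H].
    intros n; split; [apply Rabs_pos|].
    exact (re_le_Cmod (v n - z)).
  - assert (HI : Rabs (Im z) <= 0).
    { change (Rbar_le (Rabs (Im z)) 0).
      apply is_lim_seq_le with (fun _ => Rabs (Im z)) (fun n => Cmod (v n - z));
        [|apply is_lim_seq_const|exact H].
      intros n.
      eapply Rle_trans; [|apply Im_le_Cmod].
      unfold Cminus, Cplus, Copp, RtoC, Im; simpl.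
      rewrite Rplus_0_l, Rabs_Ropp; apply Rle_refl. }
    destruct z as [x y]; unfold RtoC, Re, Im in *; simpl in *.
    f_equal; symmetry; apply Rabs_eq_0.
    pose proof (Rabs_pos y); lra.
Qed.

Lemma is_lim_seq_0_const (r : R) (u : nat -> R) :
  (forall n, Rabs r <= u n) -> is_lim_seq u 0 -> r = 0.
Proof.
  intros Hr Hu; apply Rabs_eq_0.
  assert (H : Rbar_le (Rabs r) 0)
    by (eapply is_lim_seq_le; [exact Hr|apply is_lim_seq_const|exact Hu]).
  simpl in H; pose proof (Rabs_pos r); lra.
Qed.

(** If [Y 0] vanished, the error bound would force [Y 1] to vanish, and the
    recurrence would then propagate zero to all indices. *)
Lemma decaying_solution_head (s : nat -> R) (Y : nat -> C) :
  (forall k, (1 <= k)%nat -> 1 <= s k) ->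
  (forall k, Y k = (s (S k) * Y (S k) + Y (S (S k)))%C) ->
  is_lim_seq (fun n => Cmod (Y n)) 0 ->
  (exists n, Y n <> 0) -> Y 0%nat <> 0.
Proof.
  intros Hge HY Hlim Hne E.
  apply is_lim_seq_incr_1 in Hlim.
  assert (E1 : Y 1%nat = 0).
  { apply Cmod_eq_0, is_lim_seq_0_const with (2 := Hlim).
    intros n; rewrite Rabs_pos_eq by apply Cmod_ge_0.
    eapply Rle_trans; [|apply (convergent_error s Y n Hge HY)].
    rewrite E.
    replace (convergent s n * 0 - (s 0%nat * 0 + Y 1%nat))%C with (- Y 1%nat)%C by ring.
    rewrite Cmod_opp; apply Rle_refl. }
  assert (Hall : forall n, Y n = 0 /\ Y (S n) = 0).
  { induction n as [|n [IH1 IH2]]; [now split|split; [exact IH2|]].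
    rewrite (HY n), IH2 in IH1.
    rewrite <- IH1; ring. }
  destruct Hne as [n Hn]; apply Hn, Hall.
Qed.

(** A form of Pincherle's criterion.  Dividing the bound of [convergent_error] by
    [Y 0] gives the convergence of the convergents and their limit together. *)
Lemma regular_cf_value_of_decaying (s : nat -> R) (Y : nat -> C) :
  regular_cf s ->
  (forall k, Y k = (s (S k) * Y (S k) + Y (S (S k)))%C) ->
  is_lim_seq (fun n => Cmod (Y n)) 0 ->
  (exists n, Y n <> 0) ->
  regular_cf_value s (s 0%nat + Y 1%nat / Y 0%nat)%C.
Proof.
  intros Hs HY Hlim Hne; split; [exact Hs|].
  pose proof (regular_cf_ge_1 s Hs) as Hge.
  pose proof (decaying_solution_head s Y Hge HY Hlim Hne) as HY0.
  apply is_lim_seq_incr_1 in Hlim.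
  exists (Re (s 0%nat + Y 1%nat / Y 0%nat)%C).
  apply real_limit_of_complex.
  assert (Hpos : 0 < Cmod (Y 0%nat)) by (apply Cmod_gt_0, HY0).
  apply is_lim_seq_le_le with (fun _ => 0) (fun n => Cmod (Y (S n)) * / Cmod (Y 0%nat)).
  - intros n; split; [apply Cmod_ge_0|].
    replace (convergent s n - (s 0%nat + Y 1%nat / Y 0%nat))%C
      with ((convergent s n * Y 0%nat - (s 0%nat * Y 0%nat + Y 1%nat)) / Y 0%nat)%C
      by (field; exact HY0).
    rewrite Cmod_div by exact HY0.
    apply Rmult_le_compat_r;
      [left; apply Rinv_0_lt_compat, Hpos | apply convergent_error; assumption].
  - apply is_lim_seq_const.
  - replace (Finite 0) with (Finite (0 * / Cmod (Y 0%nat))) by (f_equal; ring).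
    apply is_lim_seq_mult'; [exact Hlim | apply is_lim_seq_const].
Qed.

(** * Complex series *)

(** Convergence holds for [C] as a normed module over itself, where series can
    be multiplied by complex scalars; the topology is the one of [C] over [R]. *)
Lemma is_series_CSeries (u : nat -> C) (b : nat -> R) :
  (forall n, Cmod (u n) <= b n) -> ex_series b ->
  @is_series C_AbsRing C_NormedModule u (CSeries u).
Proof.
  intros Hu Hb.
  destruct (@ex_series_le C_AbsRing C_CompleteNormedModule u b Hu Hb) as [l Hl].
  rewrite (CSeries_unique u l Hl); exact Hl.
Qed.

Lemma Cmod_series_le (u : nat -> C) (l : C) (b : nat -> R) (m : R) :
  (forall n, Cmod (u n) <= b n) ->
  @is_series C_AbsRing C_NormedModule u l -> is_series b m -> Cmod l <= m.
Proof.
  intros Hu Hl Hm.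
  change (Rbar_le (Cmod l) m).
  apply is_lim_seq_le with (fun n => Cmod (sum_n u n)) (sum_n b).
  - intros n; unfold sum_n.
    eapply Rle_trans; [exact (norm_sum_n_m u 0 n)|].
    apply sum_n_m_le, Hu.
  - exact (filterlim_comp _ _ _ _ _ _ _ _ Hl (@filterlim_norm C_AbsRing C_NormedModule l)).
  - exact Hm.
Qed.

Lemma telescoping_series (u D : nat -> C) (l : C) :
  (forall n, u n = (D n - D (S n))%C) ->
  is_lim_seq (fun n => Cmod (D n)) 0 ->
  @is_series C_AbsRing C_NormedModule u l -> l = D 0%nat.
Proof.
  intros Hu HD Hl.
  assert (Hs : forall n, sum_n u n = (D 0%nat - D (S n))%C).
  { induction n as [|n IH]; [rewrite sum_O; apply Hu|].
    rewrite sum_Sn, IH, (Hu (S n)).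
    change (D 0%nat - D (S n) + (D (S n) - D (S (S n))) = D 0%nat - D (S (S n)))%C; ring. }
  assert (Hd : (l - D 0%nat)%C = 0).
  { apply Cmod_eq_0.
    assert (H : is_lim_seq (fun n => Cmod (sum_n u n - D 0%nat)) (Cmod (l - D 0%nat))).
    { refine (filterlim_comp _ _ _ (fun n => (sum_n u n - D 0%nat)%C) Cmod _ _ _ _
               (@filterlim_norm C_AbsRing C_NormedModule _)).
      exact (filterlim_comp_2 _ (fun _ => (- D 0%nat)%C) plus Hl
               (filterlim_const _)
               (@filterlim_plus C_AbsRing C_NormedModule l (- D 0%nat)%C)). }
    apply is_lim_seq_unique in H.
    assert (H0 : is_lim_seq (fun n => Cmod (sum_n u n - D 0%nat)) 0).
    { apply is_lim_seq_ext with (fun n => Cmod (D (S n))).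
      - intros n; rewrite Hs, <- Cmod_opp; f_equal; ring.
      - apply is_lim_seq_incr_1 in HD; exact HD. }
    apply is_lim_seq_unique in H0; rewrite H in H0; now injection H0. }
  apply Ceq_minus, Hd.
Qed.

(** * The basic hypergeometric series *)

Definition Fterm (x y q : C) (n : nat) : C :=
  ((- (1)) ^ n * x ^ n * q ^ (n * (n + 1) / 2)%nat
   / (qpoch q q n * qpoch (x * q / y) q n))%C.

Lemma one_minus_lower (z : C) (r : R) : Cmod z <= r -> 1 - r <= Cmod (1 - z).
Proof.
  intros H.
  pose proof (Cmod_triangle (1 - z) z) as Ht.
  replace (1 - z + z)%C with (RtoC 1) in Ht by ring.
  rewrite Cmod_1 in Ht; lra.
Qed.

Lemma one_minus_neq_0 (z : C) : Cmod z <= / 2 -> (1 - z)%C <> 0.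
Proof. intros H; apply Cmod_gt_0; pose proof (one_minus_lower z _ H); lra. Qed.

Lemma Cmod_geom_le (z q : C) (r : R) (n : nat) :
  Cmod z <= r -> Cmod q <= / 2 -> Cmod (z * q ^ n) <= r * (/ 2) ^ n.
Proof.
  intros Hz Hq; rewrite Cmod_mult, Cmod_pow.
  apply Rmult_le_compat; try apply Cmod_ge_0; auto.
  - apply pow_le, Cmod_ge_0.
  - apply pow_incr; split; [apply Cmod_ge_0|exact Hq].
Qed.

Lemma pow_half_le_1 (n : nat) : 0 < (/ 2) ^ n <= 1.
Proof.
  split; [apply pow_lt; lra|].
  induction n as [|n IH]; simpl; [lra|].
  assert (0 < (/2)^n) by (apply pow_lt; lra); lra.
Qed.

Lemma Cmod_geom_le_half (z q : C) (n : nat) :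
  Cmod z <= / 2 -> Cmod q <= / 2 -> Cmod (z * q ^ n) <= / 2.
Proof.
  intros Hz Hq; pose proof (Cmod_geom_le z q _ n Hz Hq); pose proof (pow_half_le_1 n); lra.
Qed.

Lemma qpoch_neq_0 (z q : C) (n : nat) :
  Cmod z <= / 2 -> Cmod q <= / 2 -> qpoch z q n <> 0.
Proof.
  intros Hz Hq; induction n as [|n IH]; simpl.
  - apply C1_nz.
  - apply Cmult_neq_0; [exact IH | apply one_minus_neq_0, Cmod_geom_le_half; assumption].
Qed.

Lemma qpoch_shift (z q : C) (n : nat) :
  ((1 - z) * qpoch (z * q) q n)%C = (qpoch z q n * (1 - z * q ^ n))%C.
Proof.
  induction n as [|n IH]; simpl; [ring|].
  rewrite Cmult_assoc, IH; ring.
Qed.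

Lemma triangular_S (n : nat) : (S n * (S n + 1) / 2 = n * (n + 1) / 2 + S n)%nat.
Proof.
  replace (S n * (S n + 1))%nat with (n * (n + 1) + S n * 2)%nat by ring.
  apply Nat.div_add; lia.
Qed.

Lemma Cmod_div_unit (z y : C) : Cmod y = 1 -> Cmod (z / y) = Cmod z.
Proof.
  intros Hy.
  assert (y <> 0) by (apply Cmod_gt_0; lra).
  rewrite Cmod_div, Hy by assumption; field.
Qed.

Lemma Fterm_S (x y q : C) (n : nat) :
  Cmod q <= / 2 -> Cmod y = 1 -> Cmod (x * q) <= / 2 ->
  Fterm x y q (S n)
  = (Fterm x y q n
     * (- (x * q * q ^ n) / ((1 - q * q ^ n) * (1 - x * q / y * q ^ n))))%C.
Proof.
  intros Hq Hy Hx.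
  assert (Hy0 : y <> 0) by (apply Cmod_gt_0; lra).
  rewrite <- (Cmod_div_unit _ y Hy) in Hx.
  unfold Fterm; rewrite triangular_S, Cpow_add_r, !Cpow_S; simpl qpoch.
  set (t := (x * q / y)%C) in *.
  field; repeat split; try (apply qpoch_neq_0; assumption);
    apply one_minus_neq_0, Cmod_geom_le_half; assumption.
Qed.

Lemma Fterm_0 (x y q : C) : Fterm x y q 0 = 1.
Proof. unfold Fterm; simpl; field. Qed.

(** The first ratio of consecutive terms is at most [4 |xq|], since both of its
    denominators are at least 1/2; every later ratio is at most
    (1/4)/(3/4)^2 = 4/9. *)
Lemma Fterm_bound (x y q : C) (n : nat) :
  Cmod q <= / 2 -> Cmod y = 1 -> Cmod (x * q) <= / 2 ->
  Cmod (Fterm x y q (S n)) <= 4 * Cmod (x * q) * (/ 2) ^ n.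
Proof.
  intros Hq Hy Hx.
  assert (Ht : Cmod (x * q / y) <= / 2) by (rewrite Cmod_div_unit; assumption).
  assert (Hr : forall k,
    Cmod (- (x * q * q ^ k) / ((1 - q * q ^ k) * (1 - x * q / y * q ^ k)))
    <= Cmod (x * q) * (/ 2) ^ k / ((1 - / 2 * (/ 2) ^ k) * (1 - / 2 * (/ 2) ^ k))).
  { intros k.
    pose proof (pow_half_le_1 k) as Hk.
    pose proof (one_minus_lower _ _ (Cmod_geom_le q q _ k Hq Hq)) as H1.
    pose proof (one_minus_lower _ _ (Cmod_geom_le _ q _ k Ht Hq)) as H2.
    rewrite Cmod_div, Cmod_opp, (Cmod_mult (1 - q * q ^ k)).
    2:{ apply Cmult_neq_0; apply one_minus_neq_0, Cmod_geom_le_half; assumption. }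
    apply Rmult_le_compat.
    - apply Cmod_ge_0.
    - left; apply Rinv_0_lt_compat, Rmult_lt_0_compat; lra.
    - apply Cmod_geom_le; [apply Rle_refl | exact Hq].
    - apply Rinv_le_contravar; [apply Rmult_lt_0_compat; lra|].
      apply Rmult_le_compat; lra. }
  pose proof (Cmod_ge_0 (x * q)) as Hpos.
  induction n as [|n IH].
  - rewrite Fterm_S, Fterm_0, Cmod_mult, Cmod_1 by assumption.
    specialize (Hr 0%nat).
    eapply Rle_trans; [rewrite Rmult_1_l; exact Hr|].
    simpl; right; field.
  - rewrite Fterm_S, Cmod_mult by assumption.
    replace (4 * Cmod (x * q) * (/ 2) ^ S n)
      with (4 * Cmod (x * q) * (/ 2) ^ n * / 2) by (simpl; ring).
    apply Rmult_le_compat; try apply Cmod_ge_0; [exact IH|].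
    eapply Rle_trans; [apply Hr|].
    pose proof (pow_half_le_1 n) as Hn; simpl.
    set (h := (/ 2) ^ n) in *.
    apply Rmult_le_reg_r with ((1 - / 2 * (/ 2 * h)) * (1 - / 2 * (/ 2 * h)));
      [apply Rmult_lt_0_compat; lra|].
    unfold Rdiv; rewrite Rmult_assoc, Rinv_l by (apply Rgt_not_eq, Rmult_lt_0_compat; lra).
    rewrite Rmult_1_r; nra.
Qed.

Lemma is_series_half (r : R) : is_series (fun n => r * (/ 2) ^ n) (2 * r).
Proof.
  replace (2 * r) with (scal r (/ (1 - / 2))) by (change (r * / (1 - / 2) = 2 * r); field).
  apply (@is_series_scal R_AbsRing R_NormedModule r), is_series_geom.
  rewrite Rabs_pos_eq; lra.
Qed.

Lemma F_is_series (x y q : C) :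
  Cmod q <= / 2 -> Cmod y = 1 -> Cmod (x * q) <= / 2 ->
  @is_series C_AbsRing C_NormedModule (Fterm x y q) (F x y q).
Proof.
  intros Hq Hy Hx.
  apply is_series_CSeries with (fun n => 4 * (/ 2) ^ n);
    [|eexists; apply is_series_half].
  intros [|n].
  - rewrite Fterm_0, Cmod_1; simpl; lra.
  - eapply Rle_trans; [apply Fterm_bound; assumption|].
    pose proof (pow_half_le_1 n); simpl; nra.
Qed.

(** This gives at once the boundedness of [F] along the orbit [x q^n] and its
    convergence to 1 there. *)
Lemma F_near_1 (x y q : C) :
  Cmod q <= / 2 -> Cmod y = 1 -> Cmod (x * q) <= / 2 ->
  Cmod (F x y q - 1) <= 8 * Cmod (x * q).
Proof.
  intros Hq Hy Hx.
  apply Cmod_series_le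
    with (fun n => Fterm x y q (S n)) (fun n => 4 * Cmod (x * q) * (/ 2) ^ n).
  - intros n; apply Fterm_bound; assumption.
  - pose proof (F_is_series x y q Hq Hy Hx) as HF.
    replace (F x y q) with ((F x y q - 1) + Fterm x y q 0)%C in HF
      by (rewrite Fterm_0; ring).
    exact (@is_series_incr_1 C_AbsRing C_NormedModule _ _ HF).
  - replace (8 * Cmod (x * q)) with (2 * (4 * Cmod (x * q))) by ring.
    apply is_series_half.
Qed.

(** Replacing [x] by [x q] shifts [(t;q)_n] to [(tq;q)_n], which is a rational
    multiple of it; so all the terms of [F_qdiff] are multiples of one term. *)
Lemma Fterm_scale (x y q : C) (n : nat) :
  Cmod q <= / 2 -> Cmod y = 1 -> Cmod (x * q) <= / 2 ->
  Fterm (x * q) y q n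
  = (Fterm x y q n * (q ^ n * (1 - x * q / y) / (1 - x * q / y * q ^ n)))%C.
Proof.
  intros Hq Hy Hx.
  assert (Hy0 : y <> 0) by (apply Cmod_gt_0; lra).
  rewrite <- (Cmod_div_unit _ y Hy) in Hx.
  unfold Fterm.
  replace (x * q * q / y)%C with (x * q / y * q)%C by (field; exact Hy0).
  set (t := (x * q / y)%C) in *.
  assert (H1 : (1 - t)%C <> 0) by (apply one_minus_neq_0, Hx).
  assert (H2 : (1 - t * q ^ n)%C <> 0)
    by (apply one_minus_neq_0, Cmod_geom_le_half; assumption).
  replace (qpoch (t * q) q n) with (qpoch t q n * (1 - t * q ^ n) / (1 - t))%C
    by (rewrite <- qpoch_shift; field; exact H1).
  rewrite Cpow_mult_l.
  field; repeat split; try (apply qpoch_neq_0; assumption); assumption.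
Qed.

Lemma Cmod_scale_half (z q : C) :
  Cmod q <= / 2 -> Cmod z <= / 2 -> Cmod (z * q) <= / 2.
Proof.
  intros Hq Hz; rewrite Cmod_mult.
  pose proof (Cmod_ge_0 z); pose proof (Cmod_ge_0 q); nra.
Qed.

(** Termwise, the difference of the two sides is [D n - D (S n)] where
    [D n = Fterm x y q n * (1 - q^n) / (1 - t q^n)]; this vanishes at [n = 0]
    and tends to 0. *)
Lemma F_qdiff (x y q : C) :
  Cmod q <= / 2 -> Cmod y = 1 -> Cmod (x * q) <= / 2 ->
  let t := (x * q / y)%C in
  F x y q
  = ((1 - x * q - t) / (1 - t) * F (x * q) y q
     - x * q * t * q / ((1 - t) * (1 - t * q)) * F (x * q * q) y q)%C.
Proof.
  intros Hq Hy Hx t.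
  assert (Hy0 : y <> 0) by (apply Cmod_gt_0; lra).
  assert (Hxq : Cmod (x * q * q) <= / 2) by (apply Cmod_scale_half; assumption).
  assert (Hxqq : Cmod (x * q * q * q) <= / 2) by (apply Cmod_scale_half; assumption).
  assert (Ht : Cmod t <= / 2) by (unfold t; rewrite Cmod_div_unit; assumption).
  assert (Hg : forall n, (1 - t * q ^ n)%C <> 0)
    by (intros n; apply one_minus_neq_0, Cmod_geom_le_half; assumption).
  assert (H1 : (1 - t)%C <> 0) by (apply one_minus_neq_0, Ht).
  assert (H2 : (1 - t * q)%C <> 0)
    by (apply one_minus_neq_0, Cmod_scale_half; assumption).
  set (A := ((1 - x * q - t) / (1 - t))%C).
  set (B := (x * q * t * q / ((1 - t) * (1 - t * q)))%C).
  pose proof (F_is_series x y q Hq Hy Hx) as S0.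
  pose proof (F_is_series (x * q) y q Hq Hy Hxq) as S1.
  pose proof (F_is_series (x * q * q) y q Hq Hy Hxqq) as S2.
  apply (@is_series_scal C_AbsRing C_NormedModule (- A)%C) in S1.
  apply (@is_series_scal C_AbsRing C_NormedModule B) in S2.
  pose proof (@is_series_plus C_AbsRing C_NormedModule _ _ _ _
                (@is_series_plus C_AbsRing C_NormedModule _ _ _ _ S0 S1) S2) as HS.
  apply (telescoping_series _
           (fun n => Fterm x y q n * ((1 - q ^ n) / (1 - t * q ^ n)))%C) in HS.
  - change (F x y q + - A * F (x * q) y q + B * F (x * q * q) y q
            = Fterm x y q 0 * ((1 - 1) / (1 - t * 1)))%C in HS.
    replace (Fterm x y q 0 * ((1 - 1) / (1 - t * 1)))%C with (RtoC 0) in HS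
      by (field; replace (1 - t * 1)%C with (1 - t)%C by ring; exact H1).
    apply Ceq_minus; rewrite <- HS; ring.
  - intros n.
    change (Fterm x y q n + - A * Fterm (x * q) y q n + B * Fterm (x * q * q) y q n
            = Fterm x y q n * ((1 - q ^ n) / (1 - t * q ^ n))
              - Fterm x y q (S n) * ((1 - q ^ S n) / (1 - t * q ^ S n)))%C.
    rewrite (Fterm_scale (x * q)), (Fterm_scale x), Fterm_S by assumption.
    replace (x * q * q / y)%C with (t * q)%C by (unfold t; field; exact Hy0).
    fold t; unfold A, B.
    pose proof (Hg n) as Hn; pose proof (Hg (S n)) as HSn.
    rewrite Cpow_S in *.
    assert (Hqn : (1 - q * q ^ n)%C <> 0)
      by (apply one_minus_neq_0, Cmod_geom_le_half; assumption).
    set (Q := (q ^ n)%C) in *.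
    replace (t * (q * Q))%C with (t * q * Q)%C in HSn |- * by ring.
    field; repeat split; assumption.
  - apply is_lim_seq_incr_1.
    apply is_lim_seq_le_le with (fun _ => 0) (fun n => 8 * (/ 2) ^ n).
    + intros n; split; [apply Cmod_ge_0|].
      rewrite Cmod_mult.
      replace (8 * (/ 2) ^ n) with (4 * / 2 * (/ 2) ^ n * 4) by field.
      apply Rmult_le_compat; try apply Cmod_ge_0.
      * eapply Rle_trans; [apply Fterm_bound; assumption|].
        pose proof (pow_half_le_1 n); nra.
      * rewrite Cmod_div by apply Hg.
        assert (Hlow : / 2 <= Cmod (1 - t * q ^ S n)).
        { pose proof (one_minus_lower _ _ (Cmod_geom_le_half t q (S n) Ht Hq)); lra. }
        assert (Hup : Cmod (1 - q ^ S n) <= 2).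
        { eapply Rle_trans; [apply Cmod_triangle|].
          rewrite Cmod_opp, Cmod_1, Cpow_S.
          pose proof (Cmod_geom_le_half q q n Hq Hq); lra. }
        apply Rle_div_l; [lra|].
        lra.
    + apply is_lim_seq_const.
    + replace (Finite 0) with (Finite (8 * 0)) by (f_equal; ring).
      apply is_lim_seq_mult'; [apply is_lim_seq_const|].
      apply is_lim_seq_geom; rewrite Rabs_pos_eq; lra.
Qed.

(** * The cube root of unity *)

Lemma omega_alg : omega = (- (1) / 2, sqrt 3 / 2)%R.
Proof.
  unfold omega, Cexp.
  replace (2 * PI * Ci / 3)%C with ((0, 2 * (PI / 3)) : C)
    by (apply injective_projections; simpl; field).
  simpl; rewrite exp_0, !Rmult_1_l, cos_2PI3, sin_2PI3; f_equal; lra.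
Qed.

Lemma omega_sum : (1 + omega + omega ^ 2)%C = 0.
Proof.
  rewrite omega_alg.
  pose proof (sqrt_sqrt 3 ltac:(lra)) as H.
  apply injective_projections; simpl; lra.
Qed.

Lemma omega_cubed : (omega * omega * omega)%C = 1.
Proof.
  transitivity (1 + (omega - 1) * (1 + omega + omega ^ 2))%C; [ring|].
  rewrite omega_sum; ring.
Qed.

Lemma omega_neq_0 : omega <> 0.
Proof. intros E; pose proof omega_cubed as H; rewrite E in H; apply C1_nz; rewrite <- H; ring. Qed.

Lemma Cmod_omega : Cmod omega = 1.
Proof.
  rewrite omega_alg; unfold Cmod; simpl.
  pose proof (sqrt_sqrt 3 ltac:(lra)) as H.
  replace (_ + _) with 1 by lra.
  apply sqrt_1.
Qed.

(** * The decaying solution *)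

(** Each factor combines two normalisations.  Dividing by the factor
    [1 - t q^m], where [t q^m = sigma eps^(m+1) (c/a^(m+1)) omega^2], clears
    the denominators of the q-difference equation (in place of multiplying [F]
    by the infinite product [(t;q)_oo]); the numerator [c/a^(m+1)] scales the
    coefficients to those of a continued fraction with numerators 1 or -1. *)
Fixpoint shift_weight (a c eps sigma : R) (n : nat) : C :=
  match n with
  | O => 1
  | S m => (shift_weight a c eps sigma m
            * ((c / a ^ S m)%R
               / (1 - sigma * eps ^ S m * (c / a ^ S m)%R * omega ^ 2)))%C
  end.

Definition decaying (a c eps sigma : R) (n : nat) : C :=
  (F (sigma * c * omega * (eps / a) ^ n) (omega ^ 2) (eps / a)
   * shift_weight a c eps sigma n)%C.

Lemma Rabs_unit (e : R) : e * e = 1 -> Rabs e = 1.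
Proof.
  intros H.
  destruct (Rmult_integral (e - 1) (e + 1)) as [E|E]; [nra| |].
  - replace e with 1 by lra; apply Rabs_R1.
  - replace e with (- (1)) by lra; rewrite Rabs_Ropp; apply Rabs_R1.
Qed.

(** The signs [eps] and [sigma] select the expansion.  The bound [c / a <= 1/2]
    holds as soon as [a / c] is an integer greater than 1. *)
Definition admissible (a c eps sigma : R) : Prop :=
  2 <= a /\ 0 < c /\ 2 * c <= a /\ eps * eps = 1 /\ sigma * sigma = 1.

Lemma quotient_bound (a c : R) (n : nat) :
  2 <= a -> 0 < c -> 2 * c <= a -> 0 < c / a ^ S n <= / 2 * (/ 2) ^ n.
Proof.
  intros Ha Hc Hca.
  assert (Hp : 0 < a ^ n) by (apply pow_lt; lra).
  simpl; split.
  - apply Rdiv_lt_0_compat; [exact Hc|]; apply Rmult_lt_0_compat; lra.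
  - replace (c / (a * a ^ n)) with (c / a * / a ^ n) by (field; lra).
    apply Rmult_le_compat.
    + apply Rlt_le, Rdiv_lt_0_compat; lra.
    + apply Rlt_le, Rinv_0_lt_compat, Hp.
    + apply Rle_div_l; lra.
    + rewrite pow_inv; apply Rinv_le_contravar; [apply pow_lt; lra|].
      apply pow_incr; lra.
Qed.

Lemma RtoC_neq_0 (r : R) : r <> 0 -> RtoC r <> 0.
Proof. intros H E; apply H, RtoC_inj, E. Qed.

Lemma argument_shift (a c eps sigma : R) (n : nat) :
  2 <= a ->
  (sigma * c * omega * (eps / a) ^ n * (eps / a)
   = sigma * eps ^ S n * (c / a ^ S n)%R * omega)%C.
Proof.
  intros Ha.
  assert (Ha0 : RtoC a <> 0) by (apply RtoC_neq_0; lra).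
  assert (Han : a ^ S n <> 0) by (apply pow_nonzero; lra).
  rewrite RtoC_div, RtoC_pow by exact Han.
  unfold Cdiv; rewrite Cpow_mult_l, Cpow_inv, !Cpow_S by exact Ha0.
  field; split; [apply Cpow_nz|]; exact Ha0.
Qed.

Lemma div_omega_sqr (z : C) : (z * omega / omega ^ 2 = z * omega ^ 2)%C.
Proof.
  pose proof omega_neq_0 as H0; pose proof omega_cubed as H3.
  transitivity (z * omega / omega ^ 2 * (omega * omega * omega))%C.
  - rewrite H3; ring.
  - field; exact H0.
Qed.

Lemma Cmod_omega_sqr : Cmod (omega ^ 2) = 1.
Proof. rewrite Cmod_pow, Cmod_omega; ring. Qed.

Lemma Cmod_base (a eps : R) : 2 <= a -> eps * eps = 1 -> Cmod (eps / a) <= / 2.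
Proof.
  intros Ha He.
  rewrite Cmod_div, !Cmod_R, (Rabs_unit eps He), Rabs_pos_eq by (try apply RtoC_neq_0; lra).
  unfold Rdiv; rewrite Rmult_1_l; apply Rinv_le_contravar; lra.
Qed.

Lemma Cmod_argument (a c eps sigma : R) (n : nat) (w : C) :
  admissible a c eps sigma -> Cmod w = 1 ->
  Cmod (sigma * eps ^ S n * (c / a ^ S n)%R * w) = c / a ^ S n.
Proof.
  intros (Ha & Hc & Hca & He & Hs) Hw.
  pose proof (quotient_bound a c n Ha Hc Hca).
  rewrite !Cmod_mult, Cmod_pow, !Cmod_R, (Rabs_unit eps He), (Rabs_unit sigma Hs), Hw, pow1.
  rewrite Rabs_pos_eq by lra; ring.
Qed.

Lemma weight_factor_neq_0 (a c eps sigma : R) (n : nat) :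
  admissible a c eps sigma ->
  (1 - sigma * eps ^ S n * (c / a ^ S n)%R * omega ^ 2)%C <> 0.
Proof.
  intros H; apply one_minus_neq_0.
  rewrite (Cmod_argument _ _ _ _ _ _ H Cmod_omega_sqr).
  destruct H as (Ha & Hc & Hca & _).
  pose proof (quotient_bound a c n Ha Hc Hca); pose proof (pow_half_le_1 n); lra.
Qed.

(** Here the cube root of unity enters: its sum relation makes the first
    coefficient of [F_qdiff] real up to the weight, and its cube makes the
    second one real. *)
Lemma decaying_recurrence (a c eps sigma : R) (n : nat) :
  admissible a c eps sigma ->
  decaying a c eps sigma n
  = ((a ^ S n / c + sigma * eps ^ S n)%R * decaying a c eps sigma (S n)
     - eps * decaying a c eps sigma (S (S n)))%C.
Proof.
  intros H.
  pose proof (weight_factor_neq_0 a c eps sigma n H) as H1.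
  pose proof (weight_factor_neq_0 a c eps sigma (S n) H) as H2.
  pose proof (Cmod_argument a c eps sigma n omega H Cmod_omega) as Harg.
  destruct H as (Ha & Hc & Hca & He & Hs).
  pose proof (quotient_bound a c n Ha Hc Hca) as Hd.
  pose proof (pow_half_le_1 n) as Hh.
  assert (HeC : (eps * eps)%C = 1) by (rewrite <- RtoC_mult, He; reflexivity).
  assert (HsC : (sigma * sigma)%C = 1) by (rewrite <- RtoC_mult, Hs; reflexivity).
  assert (HeeC : (eps ^ S n * eps ^ S n)%C = 1)
    by (rewrite <- Cpow_mult_l, HeC; apply Cpow_1_l).
  unfold decaying.
  rewrite (F_qdiff (sigma * c * omega * (eps / a) ^ n)%C).
  2: apply Cmod_base; assumption.
  2: apply Cmod_omega_sqr.
  2: rewrite argument_shift, Harg by exact Ha; lra.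
  replace (sigma * c * omega * (eps / a) ^ S n)%C
    with (sigma * c * omega * (eps / a) ^ n * (eps / a))%C by (rewrite Cpow_S; ring).
  replace (sigma * c * omega * (eps / a) ^ S (S n))%C
    with (sigma * c * omega * (eps / a) ^ n * (eps / a) * (eps / a))%C
    by (rewrite !Cpow_S; ring).
  set (F1 := F (sigma * c * omega * (eps / a) ^ n * (eps / a)) _ _).
  set (F2 := F (sigma * c * omega * (eps / a) ^ n * (eps / a) * (eps / a)) _ _).
  rewrite argument_shift, div_omega_sqr by exact Ha.
  change (shift_weight a c eps sigma (S (S n))) with
    (shift_weight a c eps sigma (S n)
     * ((c / a ^ S (S n))%R / (1 - sigma * eps ^ S (S n) * (c / a ^ S (S n))%R * omega ^ 2)))%C.
  change (shift_weight a c eps sigma (S n)) with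
    (shift_weight a c eps sigma n
     * ((c / a ^ S n)%R / (1 - sigma * eps ^ S n * (c / a ^ S n)%R * omega ^ 2)))%C.
  set (w := shift_weight a c eps sigma n).
  assert (Ha0 : RtoC a <> 0) by (apply RtoC_neq_0; lra).
  assert (Hdd : RtoC (c / a ^ S (S n)) = ((c / a ^ S n)%R / a)%C).
  { rewrite <- RtoC_div by lra; f_equal; simpl; field; split; [apply pow_nonzero|]; lra. }
  assert (Hinv : RtoC (a ^ S n / c + sigma * eps ^ S n)
                 = (/ (c / a ^ S n)%R + sigma * eps ^ S n)%C).
  { rewrite RtoC_plus, RtoC_mult, RtoC_pow, <- RtoC_inv by lra.
    do 2 f_equal; field; split; [apply pow_nonzero|]; lra. }
  rewrite Hinv, Hdd in *.
  replace (eps ^ S (S n))%C with (eps * eps ^ S n)%C in * by (rewrite <- Cpow_S; reflexivity).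
  assert (Hd0 : RtoC (c / a ^ S n) <> 0) by (apply RtoC_neq_0; lra).
  set (d := RtoC (c / a ^ S n)) in *.
  set (e := (eps ^ S n)%C) in *.
  pose proof omega_cubed as H3; pose proof omega_sum as Hsum.
  assert (Hlin : (1 - sigma * e * d * omega - sigma * e * d * omega ^ 2
                  = 1 + sigma * e * d)%C).
  { transitivity (1 + sigma * e * d - sigma * e * d * (1 + omega + omega ^ 2))%C; [ring|].
    rewrite Hsum; ring. }
  assert (Hquad : (sigma * e * d * omega * (sigma * e * d * omega ^ 2) * (eps / a)
                   / ((1 - sigma * e * d * omega ^ 2)
                      * (1 - sigma * e * d * omega ^ 2 * (eps / a)))
                   = eps * (d / (1 - sigma * e * d * omega ^ 2)
                   * (d / a / (1 - sigma * (eps * e) * (d / a) * omega ^ 2))))%C).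
  { replace (sigma * e * d * omega ^ 2 * (eps / a))%C
      with (sigma * (eps * e) * (d / a) * omega ^ 2)%C by (field; exact Ha0).
    transitivity ((sigma * sigma) * (e * e) * (omega * omega * omega)
       * (eps * (d / (1 - sigma * e * d * omega ^ 2)
                   * (d / a / (1 - sigma * (eps * e) * (d / a) * omega ^ 2)))))%C.
    - set (z := (1 - sigma * (eps * e) * (d / a) * omega ^ 2)%C) in *.
      field; repeat split; assumption.
    - rewrite HsC, HeeC, H3; ring. }
  rewrite Hlin, Hquad.
  set (z2 := (1 - sigma * (eps * e) * (d / a) * omega ^ 2)%C) in *.
  set (z1 := (1 - sigma * e * d * omega ^ 2)%C) in *.
  field; repeat split; assumption.
Qed.

Lemma shift_weight_neq_0 (a c eps sigma : R) (n : nat) :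
  admissible a c eps sigma -> shift_weight a c eps sigma n <> 0.
Proof.
  intros H; induction n as [|n IH]; [apply C1_nz|].
  change (shift_weight a c eps sigma (S n)) with
    (shift_weight a c eps sigma n
     * ((c / a ^ S n)%R / (1 - sigma * eps ^ S n * (c / a ^ S n)%R * omega ^ 2)))%C.
  pose proof (weight_factor_neq_0 a c eps sigma n H) as H1.
  destruct H as (Ha & Hc & Hca & _).
  pose proof (quotient_bound a c n Ha Hc Hca).
  apply Cmult_neq_0; [exact IH|].
  intros E; apply (RtoC_neq_0 (c / a ^ S n)); [lra|].
  transitivity ((c / a ^ S n)%R / (1 - sigma * eps ^ S n * (c / a ^ S n)%R * omega ^ 2)
                * (1 - sigma * eps ^ S n * (c / a ^ S n)%R * omega ^ 2))%C.
  - field; exact H1.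
  - rewrite E; ring.
Qed.

(** The factor at index 0 is at most (1/2)/(1/2) = 1, which accounts for the
    constant 2; every later one is at most (1/4)/(3/4) = 1/3. *)
Lemma shift_weight_bound (a c eps sigma : R) (n : nat) :
  admissible a c eps sigma -> Cmod (shift_weight a c eps sigma n) <= 2 * (/ 2) ^ n.
Proof.
  intros H.
  assert (Hstep : forall k, Cmod (shift_weight a c eps sigma (S k))
    <= Cmod (shift_weight a c eps sigma k) * (/ 2 * (/ 2) ^ k / (1 - / 2 * (/ 2) ^ k))).
  { intros k.
    change (shift_weight a c eps sigma (S k)) with
      (shift_weight a c eps sigma k
       * ((c / a ^ S k)%R / (1 - sigma * eps ^ S k * (c / a ^ S k)%R * omega ^ 2)))%C.
    pose proof (weight_factor_neq_0 a c eps sigma k H) as H1.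
    pose proof (Cmod_argument a c eps sigma k _ H Cmod_omega_sqr) as H2.
    destruct H as (Ha & Hc & Hca & _).
    pose proof (quotient_bound a c k Ha Hc Hca) as Hd.
    pose proof (pow_half_le_1 k) as Hh.
    assert (H3 : 1 - / 2 * (/ 2) ^ k
                 <= Cmod (1 - sigma * eps ^ S k * (c / a ^ S k)%R * omega ^ 2))
      by (apply one_minus_lower; rewrite H2; lra).
    rewrite Cmod_mult, Cmod_div, Cmod_R, Rabs_pos_eq by (exact H1 || lra).
    apply Rmult_le_compat_l; [apply Cmod_ge_0|].
    apply Rmult_le_compat; [lra| |lra|].
    - apply Rlt_le, Rinv_0_lt_compat; lra.
    - apply Rinv_le_contravar; [lra|exact H3]. }
  destruct n as [|n]; [simpl; rewrite Cmod_1; lra|].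
  induction n as [|n IH].
  - eapply Rle_trans; [apply Hstep|].
    simpl; rewrite Cmod_1; right; field.
  - eapply Rle_trans; [apply Hstep|].
    replace (2 * (/ 2) ^ S (S n)) with (2 * (/ 2) ^ S n * / 2) by (simpl; ring).
    pose proof (pow_half_le_1 n) as Hh.
    apply Rmult_le_compat; [apply Cmod_ge_0| |exact IH|].
    + simpl; apply Rlt_le, Rdiv_lt_0_compat; lra.
    + simpl; apply Rle_div_l; lra.
Qed.

Lemma decaying_F_near_1 (a c eps sigma : R) (n : nat) :
  admissible a c eps sigma ->
  Cmod (F (sigma * c * omega * (eps / a) ^ n) (omega ^ 2) (eps / a) - 1) <= 4 * (/ 2) ^ n.
Proof.
  intros H.
  pose proof (Cmod_argument a c eps sigma n omega H Cmod_omega) as Harg.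
  destruct H as (Ha & Hc & Hca & He & Hs).
  pose proof (quotient_bound a c n Ha Hc Hca) as Hd.
  pose proof (pow_half_le_1 n) as Hh.
  rewrite <- argument_shift in Harg by exact Ha.
  eapply Rle_trans; [apply F_near_1|].
  - apply Cmod_base; assumption.
  - apply Cmod_omega_sqr.
  - rewrite Harg; lra.
  - rewrite Harg; lra.
Qed.

Lemma decaying_lim (a c eps sigma : R) :
  admissible a c eps sigma -> is_lim_seq (fun n => Cmod (decaying a c eps sigma n)) 0.
Proof.
  intros H.
  apply is_lim_seq_le_le with (fun _ => 0) (fun n => 10 * (/ 2) ^ n).
  - intros n; split; [apply Cmod_ge_0|].
    unfold decaying; rewrite Cmod_mult.
    replace (10 * (/ 2) ^ n) with (5 * (2 * (/ 2) ^ n)) by ring.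
    apply Rmult_le_compat; try apply Cmod_ge_0; [|apply shift_weight_bound, H].
    pose proof (decaying_F_near_1 a c eps sigma n H) as HF.
    set (f := F _ _ _) in *.
    replace f with ((f - 1) + 1)%C by ring.
    eapply Rle_trans; [apply Cmod_triangle|].
    pose proof (pow_half_le_1 n); rewrite Cmod_1; lra.
  - apply is_lim_seq_const.
  - replace (Finite 0) with (Finite (10 * 0)) by (f_equal; ring).
    apply is_lim_seq_mult'; [apply is_lim_seq_const|].
    apply is_lim_seq_geom; rewrite Rabs_pos_eq; lra.
Qed.

(** From index 3 on, [F] is within 4/8 of 1. *)
Lemma decaying_neq_0 (a c eps sigma : R) (n : nat) :
  admissible a c eps sigma -> (3 <= n)%nat -> decaying a c eps sigma n <> 0.
Proof.
  intros H Hn; apply Cmult_neq_0; [|apply shift_weight_neq_0, H].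
  intros E.
  pose proof (decaying_F_near_1 a c eps sigma n H) as HF.
  rewrite E in HF.
  replace (0 - 1)%C with (- (1))%C in HF by ring.
  rewrite Cmod_m1 in HF.
  replace n with (3 + (n - 3))%nat in HF by lia.
  rewrite pow_add in HF; pose proof (pow_half_le_1 (n - 3)); simpl in HF; lra.
Qed.

Lemma decaying_0 (a c eps sigma : R) :
  decaying a c eps sigma 0 = F (sigma * c * omega) (omega ^ 2) (eps / a).
Proof.
  unfold decaying; simpl shift_weight; simpl Cpow.
  rewrite !Cmult_1_r; reflexivity.
Qed.

Lemma decaying_1 (a c eps sigma : R) :
  a <> 0 ->
  decaying a c eps sigma 1
  = (c / a * F (sigma * eps * (c * omega / a)) (omega ^ 2) (eps / a)
     / (1 - sigma * eps * (c * omega ^ 2 / a)))%C.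
Proof.
  intros Ha.
  assert (Ha0 : RtoC a <> 0) by (apply RtoC_neq_0, Ha).
  unfold decaying, shift_weight; rewrite pow_1, RtoC_div by exact Ha.
  replace (sigma * c * omega * (eps / a) ^ 1)%C
    with (sigma * eps * (c * omega / a))%C by (simpl; field; exact Ha0).
  replace (sigma * eps ^ 1 * (c / a) * omega ^ 2)%C
    with (sigma * eps * (c * omega ^ 2 / a))%C by (simpl; field; exact Ha0).
  unfold Cdiv; ring.
Qed.

Lemma decaying_ratio (a c eps sigma : R) (x0 x1 q D : C) :
  admissible a c eps sigma -> decaying a c eps sigma 0 <> 0 ->
  x0 = (sigma * c * omega)%C -> x1 = (sigma * eps * (c * omega / a))%C ->
  q = (eps / a)%C -> D = (1 - sigma * eps * (c * omega ^ 2 / a))%C ->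
  (decaying a c eps sigma 1 / decaying a c eps sigma 0
   = c / a * F x1 (omega ^ 2) q / (D * F x0 (omega ^ 2) q))%C.
Proof.
  intros H H0 -> -> -> ->.
  pose proof (weight_factor_neq_0 a c eps sigma 0 H) as HD.
  assert (Ha : a <> 0) by (destruct H; lra).
  assert (Ha0 : RtoC a <> 0) by (apply RtoC_neq_0, Ha).
  rewrite decaying_1 by exact Ha; rewrite decaying_0 in *.
  replace (sigma * eps ^ 1 * (c / a ^ 1)%R * omega ^ 2)%C
    with (sigma * eps * (c * omega ^ 2 / a))%C in HD
    by (rewrite pow_1, RtoC_div by exact Ha; simpl; field; exact Ha0).
  set (f0 := F (sigma * c * omega) _ _) in *.
  set (f1 := F (sigma * eps * (c * omega / a)) _ _).
  set (d := (1 - sigma * eps * (c * omega ^ 2 / a))%C) in *.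
  field; repeat split; assumption.
Qed.

(** * Partial quotients given by blocks *)

Definition pos_int (r : R) : Prop := 0 < r /\ exists z : Z, r = IZR z.

Lemma blocks_pre (pre : list R) (fs : list (nat -> R)) (n : nat) :
  (n < length pre)%nat -> blocks pre fs n = nth n pre 0.
Proof. intros H; unfold blocks; apply Nat.ltb_lt in H; rewrite H; reflexivity. Qed.

Lemma blocks_even (pre : list R) (f g : nat -> R) (k : nat) :
  blocks pre [f; g] (length pre + 2 * k) = f (k + 1)%nat.
Proof.
  unfold blocks.
  destruct (Nat.ltb_spec (length pre + 2 * k) (length pre)) as [H|_]; [lia|].
  replace (length pre + 2 * k - length pre)%nat with (k * 2)%nat by lia.
  change (length [f; g]) with 2%nat.
  rewrite Nat.Div0.mod_mul, Nat.div_mul by lia; reflexivity.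
Qed.

Lemma blocks_odd (pre : list R) (f g : nat -> R) (k : nat) :
  blocks pre [f; g] (length pre + S (2 * k)) = g (k + 1)%nat.
Proof.
  unfold blocks.
  destruct (Nat.ltb_spec (length pre + S (2 * k)) (length pre)) as [H|_]; [lia|].
  replace (length pre + S (2 * k) - length pre)%nat with (1 + k * 2)%nat by lia.
  change (length [f; g]) with 2%nat.
  rewrite Nat.Div0.mod_add, Nat.div_add by lia; reflexivity.
Qed.

Lemma parity_cases (n : nat) : exists k, n = (2 * k)%nat \/ n = S (2 * k).
Proof.
  destruct (Nat.Even_or_Odd n) as [[k ->]|[k ->]]; exists k; [left|right]; lia.
Qed.

Lemma regular_cf_blocks (pre : list R) (f g : nat -> R) :
  List.Forall pos_int pre ->
  (forall k, pos_int (f (k + 1)%nat)) -> (forall k, pos_int (g (k + 1)%nat)) ->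
  regular_cf (blocks (0 :: pre) [f; g]).
Proof.
  intros Hpre Hf Hg.
  assert (H : forall n, pos_int (blocks (0 :: pre) [f; g] (S n))).
  { intros n; destruct (Nat.lt_ge_cases (S n) (length (0 :: pre))) as [Hn|Hn].
    - rewrite blocks_pre by exact Hn; simpl in *.
      rewrite List.Forall_forall in Hpre; apply Hpre, nth_In; lia.
    - destruct (parity_cases (S n - length (0 :: pre))) as [k [Hk|Hk]].
      + replace (S n) with (length (0%R :: pre) + 2 * k)%nat by lia.
        rewrite blocks_even; apply Hf.
      + replace (S n) with (length (0%R :: pre) + S (2 * k))%nat by lia.
        rewrite blocks_odd; apply Hg. }
  split; intros [|n].
  - exists 0%Z; reflexivity.
  - apply (H n).
  - intros Hn; lia.
  - intros _; apply (H n).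
Qed.

Lemma power_quotient (a0 m : Z) (c : R) (j : nat) :
  IZR a0 / c = IZR m -> IZR a0 ^ S j / c = IZR (m * a0 ^ Z.of_nat j).
Proof.
  intros H; rewrite mult_IZR, <- pow_IZR, <- H; simpl; unfold Rdiv; ring.
Qed.

Lemma pos_int_quotient (a0 m z : Z) (c : R) (j : nat) :
  (1 < a0)%Z -> IZR a0 / c = IZR m -> (0 < m * a0 ^ Z.of_nat j + z)%Z ->
  pos_int (IZR a0 ^ S j / c + IZR z).
Proof.
  intros Ha H Hz; rewrite (power_quotient a0 m c j H), <- plus_IZR; split.
  - apply IZR_lt, Hz.
  - eexists; reflexivity.
Qed.

Definition interleave (u v : nat -> C) (n : nat) : C :=
  if Nat.even n then u (Nat.div2 n) else v (Nat.div2 n).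

Lemma interleave_even (u v : nat -> C) (k : nat) : interleave u v (2 * k) = u k.
Proof.
  unfold interleave; rewrite Nat.even_mul, Nat.div2_double; reflexivity.
Qed.

Lemma interleave_odd (u v : nat -> C) (k : nat) : interleave u v (S (2 * k)) = v k.
Proof.
  unfold interleave; rewrite Nat.even_succ, <- Nat.negb_even, Nat.even_mul.
  rewrite Nat.div2_succ_double; reflexivity.
Qed.

Lemma interleave_lim (u v : nat -> C) :
  is_lim_seq (fun n => Cmod (u n)) 0 -> is_lim_seq (fun n => Cmod (v n)) 0 ->
  is_lim_seq (fun n => Cmod (interleave u v n)) 0.
Proof.
  intros Hu Hv.
  apply is_lim_seq_spec; intros e.
  apply is_lim_seq_spec in Hu; apply is_lim_seq_spec in Hv.
  destruct (Hu e) as [N HN]; destruct (Hv e) as [M HM].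
  exists (2 * (N + M))%nat; intros n Hn.
  destruct (parity_cases n) as [k [->| ->]].
  - rewrite interleave_even; apply HN; lia.
  - rewrite interleave_odd; apply HM; lia.
Qed.

Lemma Cmod_diff_lim (u : nat -> C) :
  is_lim_seq (fun n => Cmod (u n)) 0 -> is_lim_seq (fun n => Cmod (u n - u (S n))) 0.
Proof.
  intros H; pose proof H as H1; apply is_lim_seq_incr_1 in H1.
  apply is_lim_seq_le_le with (fun _ => 0) (fun n => Cmod (u n) + Cmod (u (S n))).
  - intros n; split; [apply Cmod_ge_0|].
    eapply Rle_trans; [apply Cmod_triangle|]; rewrite Cmod_opp; lra.
  - apply is_lim_seq_const.
  - replace (Finite 0) with (Finite (0 + 0)) by (f_equal; ring).
    apply is_lim_seq_plus'; assumption.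
Qed.

(** * The four expansions *)

Lemma alternating_cf (s : nat -> R) (a c sigma : R) :
  admissible a c (- (1)) sigma -> regular_cf s -> s 0%nat = 0 ->
  (forall n, s (S n) = a ^ S n / c + sigma * (- (1)) ^ S n) ->
  decaying a c (- (1)) sigma 0 <> 0 /\
  regular_cf_value s (decaying a c (- (1)) sigma 1 / decaying a c (- (1)) sigma 0)%C.
Proof.
  intros H Hs Hs0 HsS.
  set (X := decaying a c (- (1)) sigma).
  assert (HX : forall k, X k = (s (S k) * X (S k) + X (S (S k)))%C).
  { intros k; rewrite HsS; unfold X at 1; rewrite decaying_recurrence by exact H.
    fold X; rewrite (RtoC_opp 1); ring. }
  assert (Hne : exists n, X n <> 0) by (exists 3%nat; apply decaying_neq_0; [exact H|lia]).
  pose proof (decaying_lim _ _ _ _ H) as Hlim.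
  split.
  - exact (decaying_solution_head s X (regular_cf_ge_1 s Hs) HX Hlim Hne).
  - replace (X 1%nat / X 0%nat)%C with (s 0%nat + X 1%nat / X 0%nat)%C
      by (rewrite Hs0; ring).
    exact (regular_cf_value_of_decaying s X Hs HX Hlim Hne).
Qed.

(** With [A_n = a^n / c] the solution satisfies
    [X_n = (A_(n+1) - 1) X_(n+1) - X_(n+2)].  The identity
    [(A - 1) u - v = (A - 2) u + (u - v)] at the start, and
    [(A - 1) u - v - u = (A - 3) u + (u - v)] later, show that
    [X_0, X_1, X_1 - X_2, X_2, X_2 - X_3, ...] solves the recurrence with
    quotients [A_1 - 2, 1, A_2 - 3, 1, A_3 - 3, ...]. *)
Lemma contracted_minus_cf (s : nat -> R) (a c : R) :
  admissible a c 1 (- (1)) -> regular_cf s -> s 0%nat = 0 -> s 1%nat = a / c - 2 ->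
  (forall k, s (2 + 2 * k)%nat = 1) ->
  (forall k, s (2 + S (2 * k))%nat = a ^ (S (S k)) / c - 3) ->
  decaying a c 1 (- (1)) 0 <> 0 /\
  regular_cf_value s (decaying a c 1 (- (1)) 1 / decaying a c 1 (- (1)) 0)%C.
Proof.
  intros H Hs Hs0 Hs1 Heven Hodd.
  set (X := decaying a c 1 (- (1))).
  assert (HX : forall k, X k = ((a ^ S k / c)%R * X (S k) - X (S k) - X (S (S k)))%C).
  { intros k; unfold X at 1; rewrite decaying_recurrence by exact H.
    fold X; rewrite pow1, RtoC_plus, RtoC_mult, (RtoC_opp 1); ring. }
  (* The entry at index 0 is [X 0] rather than [X 0 - X 1]: the expansion starts
     with a partial quotient, not with a block. *)
  set (Y := interleave (fun k => match k with
                                 | O => X O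
                                 | S _ => (X k - X (S k))%C
                                 end) (fun k => X (S k))).
  assert (HYe : forall k, Y (2 * S k)%nat = (X (S k) - X (S (S k)))%C)
    by (intros k; exact (interleave_even _ _ _)).
  assert (HYo : forall k, Y (S (2 * k)) = X (S k)) by (intros k; exact (interleave_odd _ _ k)).
  assert (HY0 : Y 0%nat = X 0%nat) by reflexivity.
  assert (HY : forall n, Y n = (s (S n) * Y (S n) + Y (S (S n)))%C).
  { intros n; destruct (parity_cases n) as [[|k] [->| ->]].
    - change (Y 0%nat = (s 1%nat * Y (S (2 * 0)) + Y (2 * 1)%nat)%C).
      rewrite HYo, HYe, HY0, Hs1, (HX 0%nat), RtoC_minus, pow_1; ring.
    - change (Y (S (2 * 0)) = (s (2 + 2 * 0)%nat * Y (2 * 1)%nat + Y (S (2 * 1)))%C).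
      rewrite !HYo, HYe, Heven; ring.
    - replace (S (2 * S k)) with (2 + S (2 * k))%nat by lia.
      replace (S (2 + S (2 * k))) with (2 * S (S k))%nat by lia.
      rewrite Hodd, !HYe.
      replace (2 + S (2 * k))%nat with (S (2 * S k)) by lia.
      rewrite HYo, (HX (S k)), RtoC_minus; ring.
    - replace (S (S (2 * S k))) with (2 + 2 * S k)%nat at 1 by lia.
      replace (S (S (2 * S k))) with (2 * S (S k))%nat by lia.
      rewrite Heven, !HYo, HYe; ring. }
  assert (Hlim : is_lim_seq (fun n => Cmod (Y n)) 0).
  { pose proof (decaying_lim _ _ _ _ H) as HL; fold X in HL.
    apply interleave_lim.
    - apply is_lim_seq_incr_1.
      pose proof (Cmod_diff_lim _ HL) as HD; apply is_lim_seq_incr_1 in HD; exact HD.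
    - apply is_lim_seq_incr_1 in HL; exact HL. }
  assert (Hne : exists n, Y n <> 0).
  { exists (S (2 * 2)); rewrite HYo; apply decaying_neq_0; [exact H|lia]. }
  split.
  - rewrite <- HY0.
    exact (decaying_solution_head s Y (regular_cf_ge_1 s Hs) HY Hlim Hne).
  - replace (X 1%nat / X 0%nat)%C with (s 0%nat + Y 1%nat / Y 0%nat)%C
      by (rewrite Hs0, HY0, (HYo 0%nat : Y 1%nat = _); ring).
    apply regular_cf_value_of_decaying; assumption.
Qed.

(** Now [X_n = (A_(n+1) + 1) X_(n+1) - X_(n+2)], and
    [X_0, X_0 - X_1, X_1, X_1 - X_2, ...] solves the recurrence with quotients
    [1, A_1 - 1, 1, A_2 - 1, ...]; the ratio of its first two entries is
    [1 - X_1 / X_0]. *)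
Lemma contracted_plus_cf (s : nat -> R) (a c : R) :
  admissible a c 1 1 -> regular_cf s -> s 0%nat = 0 ->
  (forall k, s (1 + 2 * k)%nat = 1) ->
  (forall k, s (1 + S (2 * k))%nat = a ^ S k / c - 1) ->
  decaying a c 1 1 0 <> 0 /\
  regular_cf_value s (1 - decaying a c 1 1 1 / decaying a c 1 1 0)%C.
Proof.
  intros H Hs Hs0 Heven Hodd.
  set (X := decaying a c 1 1).
  assert (HX : forall k, X k = ((a ^ S k / c)%R * X (S k) + X (S k) - X (S (S k)))%C).
  { intros k; unfold X at 1; rewrite decaying_recurrence by exact H.
    fold X; rewrite pow1, RtoC_plus, RtoC_mult; ring. }
  set (Y := interleave X (fun k => (X k - X (S k))%C)).
  assert (HYe : forall k, Y (2 * k)%nat = X k) by (intros k; exact (interleave_even _ _ _)).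
  assert (HYo : forall k, Y (S (2 * k)) = (X k - X (S k))%C)
    by (intros k; exact (interleave_odd _ _ k)).
  assert (HY : forall n, Y n = (s (S n) * Y (S n) + Y (S (S n)))%C).
  { intros n; destruct (parity_cases n) as [k [->| ->]].
    - replace (S (S (2 * k))) with (2 * S k)%nat by lia.
      rewrite HYo, !HYe.
      change (S (2 * k)) with (1 + 2 * k)%nat; rewrite Heven; ring.
    - replace (S (S (S (2 * k)))) with (S (2 * S k)) by lia.
      rewrite !HYo.
      change (S (S (2 * k))) with (1 + S (2 * k))%nat at 1; rewrite Hodd.
      replace (S (S (2 * k))) with (2 * S k)%nat by lia.
      rewrite HYe, (HX k), RtoC_minus; ring. }
  assert (Hlim : is_lim_seq (fun n => Cmod (Y n)) 0).
  { pose proof (decaying_lim _ _ _ _ H) as HL; fold X in HL.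
    apply interleave_lim; [exact HL | apply Cmod_diff_lim, HL]. }
  assert (Hne : exists n, Y n <> 0).
  { exists (2 * 3)%nat; rewrite HYe; apply decaying_neq_0; [exact H|lia]. }
  pose proof (decaying_solution_head s Y (regular_cf_ge_1 s Hs) HY Hlim Hne
              : X 0%nat <> 0) as HX0.
  split; [exact HX0|].
  replace (1 - X 1%nat / X 0%nat)%C with (s 0%nat + Y 1%nat / Y 0%nat)%C.
  - apply regular_cf_value_of_decaying; assumption.
  - rewrite Hs0; change (Y 0%nat) with (X 0%nat).
    change (Y 1%nat) with (X 0%nat - X 1%nat)%C; field; exact HX0.
Qed.

Theorem theorem6 (a0 : Z) (c0 : Q)
    (ha : (1 < a0)%Z)
    (hc : Q2R c0 <> 0)
    (hac : exists m : Z, (0 < m)%Z /\ IZR a0 / Q2R c0 = IZR m) :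
  let a : R := IZR a0 in
  let c : R := Q2R c0 in
  (a / c > 1 ->
    regular_cf_value
      (blocks [0] [(fun k => a ^ (2 * k - 1) / c - 1);
                   (fun k => a ^ (2 * k) / c + 1)])
      ((c / a) * F (- c * omega / a) (omega ^ 2) (- (1) / a)
       / ((1 + c * omega ^ 2 / a) * F (c * omega) (omega ^ 2) (- (1) / a)))%C
    /\
    regular_cf_value
      (blocks [0] [(fun k => a ^ (2 * k - 1) / c + 1);
                   (fun k => a ^ (2 * k) / c - 1)])
      ((c / a) * F (c * omega / a) (omega ^ 2) (- (1) / a)
       / ((1 - c * omega ^ 2 / a) * F (- c * omega) (omega ^ 2) (- (1) / a)))%C)
  /\
  (a / c > 2 ->
    regular_cf_value
      (blocks [0; a / c - 2] [(fun k => 1);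
                              (fun k => a ^ (k + 1) / c - 3)])
      ((c / a) * F (- c * omega / a) (omega ^ 2) (1 / a)
       / ((1 + c * omega ^ 2 / a) * F (- c * omega) (omega ^ 2) (1 / a)))%C
    /\
    regular_cf_value
      (blocks [0] [(fun k => 1);
                   (fun k => a ^ k / c - 1)])
      (1 - (c / a) * F (c * omega / a) (omega ^ 2) (1 / a)
       / ((1 - c * omega ^ 2 / a) * F (c * omega) (omega ^ 2) (1 / a)))%C).
Proof.
  intros a c.
  destruct hac as [m [Hm Hacm]]; fold a in Hacm; fold c in Hacm, hc.
  assert (Ha : 2 <= a) by (apply IZR_le; lia).
  assert (Ha0 : RtoC a <> 0) by (apply RtoC_neq_0; lra).
  assert (Hac : a = IZR m * c) by (rewrite <- Hacm; field; exact hc).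
  assert (Hmpos : 0 < IZR m) by (apply IZR_lt, Hm).
  assert (Hc : 0 < c) by nra.
  assert (Hadm : forall eps sigma, (2 <= m)%Z -> eps * eps = 1 -> sigma * sigma = 1 ->
                   admissible a c eps sigma).
  { intros eps sigma Hm2 He Hs; apply IZR_le in Hm2.
    repeat split; try assumption; nra. }
  assert (Hpow : forall j, (1 <= a0 ^ Z.of_nat j)%Z) by (intros j; lia || nia).
  assert (Hq : forall j z, (0 < m * a0 ^ Z.of_nat j + z)%Z -> pos_int (a ^ S j / c + IZR z))
    by (intros j z; apply pos_int_quotient; assumption).
  assert (HqS : forall j z, (0 < m + z)%Z -> pos_int (a ^ S j / c + IZR z))
    by (intros j z Hz; apply Hq; pose proof (Hpow j); nia).
  split; intros Hlt; rewrite Hacm in Hlt.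
  - assert (Hm2 : (2 <= m)%Z) by (apply lt_IZR in Hlt; lia).
    assert (Hodd : forall k, (2 * (k + 1) - 1)%nat = S (2 * k)) by (intros; lia).
    assert (Heven : forall k, (2 * (k + 1))%nat = S (S (2 * k))) by (intros; lia).
    assert (HsO : forall k, (- (1)) ^ S (2 * k) = - (1)) by exact pow_1_odd.
    assert (HsE : forall k, (- (1)) ^ S (S (2 * k)) = 1)
      by (intros k; rewrite <- tech_pow_Rmult, HsO; ring).
    split.
    + edestruct (alternating_cf
        (blocks [0] [(fun k => a ^ (2 * k - 1) / c - 1);
                     (fun k => a ^ (2 * k) / c + 1)]) a c 1) as [H0 HV].
      * apply Hadm; [exact Hm2|ring|ring].
      * apply regular_cf_blocks; [constructor| |]; intros k.
        -- rewrite Hodd; apply (HqS _ (-1)%Z); lia.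
        -- rewrite Heven; apply (HqS _ 1%Z); lia.
      * reflexivity.
      * intros n; destruct (parity_cases n) as [k [->| ->]].
        -- etransitivity; [exact (blocks_even [0] _ _ k)|].
           cbv beta; rewrite Hodd, HsO; ring.
        -- etransitivity; [exact (blocks_odd [0] _ _ k)|].
           cbv beta; rewrite Heven, HsE; ring.
      * erewrite decaying_ratio in HV;
          [exact HV|apply Hadm; [exact Hm2|ring|ring]|exact H0| | | |];
          rewrite ?(RtoC_opp 1); field; exact Ha0.
    + edestruct (alternating_cf
        (blocks [0] [(fun k => a ^ (2 * k - 1) / c + 1);
                     (fun k => a ^ (2 * k) / c - 1)]) a c (- (1))) as [H0 HV].
      * apply Hadm; [exact Hm2|ring|ring].
      * apply regular_cf_blocks; [constructor| |]; intros k.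
        -- rewrite Hodd; apply (HqS _ 1%Z); lia.
        -- rewrite Heven; apply (HqS _ (-1)%Z); lia.
      * reflexivity.
      * intros n; destruct (parity_cases n) as [k [->| ->]].
        -- etransitivity; [exact (blocks_even [0] _ _ k)|].
           cbv beta; rewrite Hodd, HsO; ring.
        -- etransitivity; [exact (blocks_odd [0] _ _ k)|].
           cbv beta; rewrite Heven, HsE; ring.
      * erewrite decaying_ratio in HV;
          [exact HV|apply Hadm; [exact Hm2|ring|ring]|exact H0| | | |];
          rewrite ?(RtoC_opp 1); field; exact Ha0.
  - assert (Hm3 : (3 <= m)%Z) by (apply lt_IZR in Hlt; lia).
    assert (HaS : a / c = a ^ 1 / c) by (rewrite pow_1; reflexivity).
    assert (Hone : pos_int 1) by (split; [lra|exists 1%Z; reflexivity]).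
    split.
    + edestruct (contracted_minus_cf
        (blocks [0; a / c - 2] [(fun k => 1);
                                (fun k => a ^ (k + 1) / c - 3)]) a c) as [H0 HV].
      * apply Hadm; [lia|ring|ring].
      * apply regular_cf_blocks; [|intros k; exact Hone|intros k].
        -- constructor; [rewrite HaS; apply (HqS _ (-2)%Z); lia|constructor].
        -- replace (k + 1 + 1)%nat with (S (S k)) by lia.
           apply (Hq (S k) (-3)%Z).
           rewrite Nat2Z.inj_succ, Z.pow_succ_r by lia.
           pose proof (Hpow k); nia.
      * reflexivity.
      * reflexivity.
      * intros k; exact (blocks_even [0; a / c - 2] _ _ k).
      * intros k; etransitivity; [exact (blocks_odd [0; a / c - 2] _ _ k)|].
        cbv beta; replace (k + 1 + 1)%nat with (S (S k)) by lia; reflexivity.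
      * erewrite decaying_ratio in HV;
          [exact HV|apply Hadm; [lia|ring|ring]|exact H0| | | |];
          rewrite ?(RtoC_opp 1); field; exact Ha0.
    + edestruct (contracted_plus_cf
        (blocks [0] [(fun k => 1); (fun k => a ^ k / c - 1)]) a c) as [H0 HV].
      * apply Hadm; [lia|ring|ring].
      * apply regular_cf_blocks; [constructor|intros k; exact Hone|intros k].
        replace (k + 1)%nat with (S k) by lia; apply (HqS _ (-1)%Z); lia.
      * reflexivity.
      * intros k; exact (blocks_even [0] _ _ k).
      * intros k; etransitivity; [exact (blocks_odd [0] _ _ k)|].
        cbv beta; replace (k + 1)%nat with (S k) by lia; reflexivity.
      * erewrite decaying_ratio in HV;
          [exact HV|apply Hadm; [lia|ring|ring]|exact H0| | | |];
          rewrite ?(RtoC_opp 1); field; exact Ha0.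
Qed.
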